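(* Let $r\geq3$. Then \begin{enumerate} \item $\det(1;T_0^{(r)},T_1^{(r)},\ldots,T_{n-1}^{(r)})=(-1)^{n-1}F_{n-r+1}$ for all $n\geq r-1$; \item $\det(1;T_{r-2}^{(r)},T_{r-1}^{(r)},\ldots,T_{n+r-3}^{(r)})=(-1)^{n-1}a_{n-2}^{(r)}$ for all $n\geq2$; \item $\det(1;T_{r-1}^{(r)},T_{r}^{(r)},\ldots,T_{n+r-2}^{(r)})=(-1)^{n-1}P_{n+r-1}^{(r)}$ for all $n\geq1$; \item $\det(1;T_{r}^{(r)},T_{r+1}^{(r)},\ldots,T_{n+r-1}^{(r)})=(-1)^{n-1}\delta_{n,r}$ for all $n\geq3$, where $\delta_{n,r}$ is the Kronecker delta. \end{enumerate}
   Context: For $r\ge3$, the generalized $r$-tribonacci numbers are defined by $T_0^{(r)}=\cdots=T_{r-2}^{(r)}=0$, $T_{r-1}^{(r)}=1$, and $T_n^{(r)}=T_{n-1}^{(r)}+T_{n-2}^{(r)}+T_{n-r}^{(r)}$ for $n\geq r$. Also $P_0^{(r)}=1$, $P_1^{(r)}=\cdots=P_{r-1}^{(r)}=0$, $P_n^{(r)}=P_{n-2}^{(r)}+P_{n-r}^{(r)}$ for $n\ge r$; and $a_0^{(r)}=\cdots=a_{r-1}^{(r)}=1$, $a_n^{(r)}=a_{n-1}^{(r)}+a_{n-r}^{(r)}$ for $n\ge r$. $F_n$ are the Fibonacci numbers ($F_0=0$, $F_1=1$, $F_n=F_{n-1}+F_{n-2}$). For numbers $a_0,\ldots,a_n$,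 $\det(a_0;a_1,\ldots,a_n)$ denotes the determinant of the $n\times n$ Toeplitz--Hessenberg matrix whose $(i,j)$ entry is $a_{i-j+1}$ if $i-j+1\ge0$ and $0$ otherwise. *)

(* Defs.v *)
From mathcomp Require Import all_boot all_order all_algebra.
Set Implicit Arguments.
Unset Strict Implicit.
Unset Printing Implicit Defensive.
Import GRing.Theory.

(* [trib r n], [pado r n] and [nara r n] are T_n^(r), P_n^(r) and a_n^(r); only
   r >= 3 is meaningful. At n = m.+1, the arguments m - 1 and m - r.-1 are n - 2
   and n - r, written through m to make the recursion structural; [tribSr],
   [padoSr] and [naraSr] give the recurrences in their usual form. *)
Fixpoint trib (r n : nat) : nat :=
  if n < r.-1 then 0 else if n == r.-1 then 1 else
  if n is m.+1 then trib r m + trib r (m - 1) + trib r (m - r.-1) else 0.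

Fixpoint pado (r n : nat) : nat :=
  if n is m.+1 then
    if n < r then 0 else pado r (m - 1) + pado r (m - r.-1)
  else 1.

Fixpoint nara (r n : nat) : nat :=
  if n < r then 1 else
  if n is m.+1 then nara r m + nara r (m - r.-1) else 1.

Fixpoint fib (n : nat) : nat :=
  if n is m.+1 then if m is p.+1 then fib m + fib p else 1 else 0.

Lemma trib_small r n : n < r.-1 -> trib r n = 0.
Proof. by case: n => [|n] /= ->. Qed.

Lemma trib_pred r : trib r r.-1 = 1.
Proof. by case: r => [|[|r]] //=; rewrite ltnn eqxx. Qed.

Lemma tribSr r n : 2 < r -> r <= n ->
  trib r n = trib r (n - 1) + trib r (n - 2) + trib r (n - r).
Proof.
case: r n => [|r] [|n] //= r_gt1 le_rn.
by rewrite ltnNge leqW //= gtn_eqF //= !subSS subn0.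
Qed.

Lemma pado0 r : pado r 0 = 1.
Proof. by []. Qed.

Lemma pado_small r n : 0 < n < r -> pado r n = 0.
Proof. by case: n => [|n] //= ->. Qed.

Lemma padoSr r n : 2 < r -> r <= n ->
  pado r n = pado r (n - 2) + pado r (n - r).
Proof. by case: r n => [|r] [|n] //= _ le_rn; rewrite ltnNge le_rn /= !subSS. Qed.

Lemma nara_small r n : n < r -> nara r n = 1.
Proof. by case: n => [|n] /= ->. Qed.

Lemma naraSr r n : 2 < r -> r <= n ->
  nara r n = nara r (n - 1) + nara r (n - r).
Proof.
by case: r n => [|r] [|n] //= _ le_rn; rewrite ltnNge le_rn /= !subSS subn0.
Qed.

Lemma fibSS n : fib n.+2 = fib n.+1 + fib n.
Proof. by []. Qed.

(* [thdet a0 a] is det(a_0; a_1, ..., a_n). The entries [i j] are 0-based, which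
   leaves i - j + 1 unchanged; the guard is i - j + 1 >= 0, so that the natural
   subtraction is exact. *)
Definition thdet (R : comNzRingType) (n : nat) (a0 : R) (a : n.-tuple R) : R :=
  (\det (\matrix_(i < n, j < n)
     if (j <= i.+1)%N then nth 0 (a0 :: a) (i.+1 - j)%N else 0))%R.

(* Main.v *)
(** Up to sign, the n x n Toeplitz--Hessenberg determinant with a_0 = 1 is the
    corner cofactor of the unitriangular (n+1) x (n+1) Toeplitz matrix of the
    a_k, so it is (-1)^n times the n-th coefficient of 1 / sum_k a_k x^k.  The
    series of T^(r), shifted by r - 1, is t = 1/q with q = 1 - x - x^2 - x^r, and
    the determinants (1)-(3) belong to 1 + x^s t with s = r, 2, 1.  The inverse
    of this series is 1 - x^s u with u = 1/(q + x^s), whose coefficients are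
    respectively Fibonacci, a^(r) and shifted P^(r) numbers.  In (4) the series
    is t itself and its inverse is q.  All series are truncated to
    polynomials. *)
Require Import Defs.
From mathcomp Require Import all_boot all_order all_algebra.
From mathcomp Require Import zify ring.
Import GRing.Theory.
Local Open Scope ring_scope.

Lemma thdet_inverse (R : comNzRingType) (n : nat) (p g : {poly R}) :
  p`_0 = 1 -> take_poly n.+1 (p * g) = 1 ->
  thdet 1 [tuple p`_k.+1 | k < n] = (-1) ^+ n * g`_n.
Proof.
move=> p0 pg1.
pose L : 'M[R]_n.+1 := \matrix_(i, j) if (j <= i)%N then p`_(i - j) else 0.
have detL : \det L = 1.
  rewrite det_trig.
    by rewrite big1 // => i _; rewrite mxE leqnn subnn.
  by apply/is_trig_mxP => i j ltij; rewrite mxE leqNgt ltij.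
(* As [\det L = 1], this makes the coefficient column of [g] the first column of [\adj L]; its last
   entry is a corner cofactor. *)
have Lg : L *m (\col_k g`_k) = delta_mx ord0 0.
  apply/matrixP=> i j; rewrite !mxE (ord1 j) eqxx andbT.
  have /polyP/(_ i) := pg1.
  rewrite coef_take_poly (ltn_ord i) coefMr coef1 -val_eqE /= => <-.
  rewrite (big_ord_widen n.+1 (fun k => p`_(i - k) * g`_k)) //.
  rewrite [RHS]big_mkcond; apply: eq_bigr => k _; rewrite !mxE ltnS.
  by case: ifP => // _; rewrite mul0r.
have : \adj L *m (L *m \col_k g`_k) = \col_k g`_k.
  by rewrite mulmxA mul_adj_mx detL mul1mx.
rewrite Lg -colE => /matrixP/(_ ord_max 0); rewrite !mxE /cofactor add0n => <-.
rewrite mulrA -exprD addnn -mul2n exprM sqrrN expr1n expr1n mul1r /thdet.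
congr (\det _); apply/matrixP => i j; rewrite !mxE /=.
rewrite /bump leq0n add1n (leqNgt n) ltn_ord add0n.
case: ifP => // leji; case E: (i.+1 - j)%N => [|k] /=; first by rewrite p0.
have ltkn : (k < n)%N by have := ltn_ord i; lia.
by rewrite -[k]/(nat_of_ord (Ordinal ltkn)) nth_mktuple.
Qed.

(** Modulo X^N, the factors are t (q + X^s) and u q, so their product is (t q) (u (q + X^s)) = 1. *)
Lemma take_poly_shift_inverse (R : comNzRingType) (N s : nat)
    (q t u : {poly R}) :
  take_poly N (t * q) = 1 -> take_poly N (u * (q + 'X^s)) = 1 ->
  take_poly N ((1 + 'X^s * t) * (1 - 'X^s * u)) = 1.
Proof.
move=> tq1 uw1.
have take1 : take_poly N 1 = 1 :> {poly R}.
  apply/polyP=> i; rewrite coef_take_poly; have /polyP/(_ i) := tq1.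
  by rewrite coef_take_poly; case: ifP.
have := poly_take_drop N (t * q); have := poly_take_drop N (u * (q + 'X^s)).
rewrite tq1 uw1; set x := drop_poly _ _; set y := drop_poly _ _ => ux ty.
(* The product minus 1 is X^s (t - u - X^s t u), and the bracket equals u (t q - 1) - t (u (q + X^s)
   - 1). *)
have -> : (1 + 'X^s * t) * (1 - 'X^s * u)
    = 1 + 'X^s * (u * y - t * x) * 'X^N.
  have -> : 'X^s * (u * y - t * x) * 'X^N
      = 'X^s * (u * (1 + y * 'X^N - 1) - t * (1 + x * 'X^N - 1)) by ring.
  by rewrite ux ty; ring.
by rewrite take_polyD take_polyMXn_0 addr0.
Qed.

(** The list [s] holds the lags of the recurrence; the filter [k <= m] extends [f] by zero to
    negative indices. *)
Lemma take_poly_recurrence (R : nzRingType) (n : nat) (s : seq nat)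
    (f : nat -> R) :
  f 0 = 1 -> all (ltn 0) s ->
  (forall m, (0 < m)%N -> f m = \sum_(k <- s | (k <= m)%N) f (m - k)%N) ->
  take_poly n.+1 (\poly_(i < n.+1) f i * (1 - \sum_(k <- s) 'X^k)) = 1.
Proof.
move=> f0 /allP s_gt0 frec; apply/polyP=> m.
rewrite coef_take_poly coef1 mulrBr mulr1 mulr_sumr coefB coef_sum.
case: ifP => [ltmn|]; last by case: m.
rewrite coef_poly ltmn.
have -> : \sum_(k <- s) (\poly_(i < n.+1) f i * 'X^k)`_m
    = \sum_(k <- s | (k <= m)%N) f (m - k)%N.
  rewrite [RHS]big_mkcond; apply: eq_bigr => k _.
  rewrite coefMXn coef_poly ltnNge; case: (k <= m)%N => //.
  by rewrite [(_ < _)%N](leq_ltn_trans (leq_subr k m) ltmn).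
case: m ltmn => [|m] _; last by rewrite frec // subrr.
rewrite big1_seq ?subr0 // => k /andP[k_le0 /s_gt0 /=].
by rewrite ltnNge k_le0.
Qed.

Lemma thdet_shift_inverse (R : comNzRingType) (n s : nat) (q : {poly R})
    (t u a : nat -> R) :
  (0 < n)%N -> (0 < s)%N ->
  take_poly n.+1 (\poly_(i < n.+1) t i * q) = 1 ->
  take_poly n.+1 (\poly_(i < n.+1) u i * (q + 'X^s)) = 1 ->
  (forall k, a k = if (k.+1 < s)%N then 0 else t (k.+1 - s)%N) ->
  thdet 1 [tuple a k | k < n] = (-1) ^+ (n - 1) * (if (n < s)%N then 0 else u (n - s)%N).
Proof.
move=> n_gt0 s_gt0 tq1 uw1 aE.
have := thdet_inverse _ _ _ _ _
  (take_poly_shift_inverse _ _ _ _ _ _ tq1 uw1).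
rewrite coefD coef1 coefXnM s_gt0 addr0 => /(_ erefl).
rewrite coefB coef1 coefXnM coef_poly ltnS leq_subr.
(* The minus sign of -X^s u lowers the exponent of -1 from n to n - 1. *)
rewrite eqn0Ngt n_gt0 -[in X in _ = X * _](subnK n_gt0) exprD.
rewrite expr1 sub0r -mulrA mulN1r opprK => <-; congr thdet.
apply: eq_mktuple => k; rewrite coefD coef1 add0r coefXnM coef_poly aE.
by case: ifP => // _; rewrite ifT //; have := ltn_ord k; lia.
Qed.

Section Series.

Variables (r n : nat).
Hypothesis r_ge3 : (3 <= r)%N.

Lemma trib_series :
  take_poly n.+1 (\poly_(i < n.+1) (trib r (r - 1 + i))%:Z
                  * (1 - \sum_(k <- [:: 1; 2; r]%N) 'X^k)) = 1.
Proof.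
apply: take_poly_recurrence => [||m m_gt0].
- by rewrite addn0 subn1 trib_pred.
- by rewrite /= (ltn_trans _ r_ge3).
rewrite !big_cons big_nil m_gt0 tribSr //; last by lia.
rewrite (_ : r - 1 + m - 1 = r - 1 + (m - 1))%N; last by lia.
(* A lag exceeding [m] leads to an index below r - 1, where T vanishes, in agreement with the
   filter. *)
case: (leqP 2 m) => m2; case: (leqP r m) => mr.
- rewrite (_ : r - 1 + m - 2 = r - 1 + (m - 2))%N; last by lia.
  by rewrite (_ : r - 1 + m - r = r - 1 + (m - r))%N; lia.
- rewrite (_ : r - 1 + m - 2 = r - 1 + (m - 2))%N; last by lia.
  by rewrite (@trib_small r (r - 1 + m - r)); lia.
- by lia.
by rewrite (@trib_small r (r - 1 + m - 2)) 1?(@trib_small r (r - 1 + m - r)); lia.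
Qed.

Lemma fib_series :
  take_poly n.+1 (\poly_(i < n.+1) (fib i.+1)%:Z
                  * (1 - \sum_(k <- [:: 1; 2; r]%N) 'X^k + 'X^r)) = 1.
Proof.
have -> : 1 - \sum_(k <- [:: 1; 2; r]%N) 'X^k + 'X^r
    = 1 - \sum_(k <- [:: 1; 2]%N) 'X^k :> {poly int}.
  by rewrite !big_cons big_nil; ring.
apply: take_poly_recurrence => // -[|[|m]] // _.
  by rewrite !big_cons big_nil.
by rewrite !big_cons big_nil addr0 !subSS !subn0.
Qed.

Lemma nara_series :
  take_poly n.+1 (\poly_(i < n.+1) (nara r i)%:Z
                  * (1 - \sum_(k <- [:: 1; 2; r]%N) 'X^k + 'X^2)) = 1.
Proof.
have -> : 1 - \sum_(k <- [:: 1; 2; r]%N) 'X^k + 'X^2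
    = 1 - \sum_(k <- [:: 1; r]%N) 'X^k :> {poly int}.
  by rewrite !big_cons big_nil; ring.
apply: take_poly_recurrence => [||m m_gt0].
- by rewrite nara_small // (ltn_trans _ r_ge3).
- by rewrite /= (ltn_trans _ r_ge3).
rewrite !big_cons big_nil m_gt0; case: (leqP r m) => mr.
  by rewrite naraSr //; lia.
by rewrite !nara_small //; lia.
Qed.

(** The series starts at P_r = P_(r-2) + P_0 = 1, so that the zeros P_1, ..., P_(r-1) stand for the
    negative indices. Starting at P_0 would fail, since P_2 = 0. *)
Lemma pado_series :
  take_poly n.+1 (\poly_(i < n.+1) (pado r (r + i))%:Z
                  * (1 - \sum_(k <- [:: 1; 2; r]%N) 'X^k + 'X^1)) = 1.
Proof.
have -> : 1 - \sum_(k <- [:: 1; 2; r]%N) 'X^k + 'X^1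
    = 1 - \sum_(k <- [:: 2; r]%N) 'X^k :> {poly int}.
  by rewrite !big_cons big_nil; ring.
apply: take_poly_recurrence => [||m m_gt0].
- rewrite addn0 padoSr // subnn pado_small //; lia.
- by rewrite /= (ltn_trans _ r_ge3).
rewrite !big_cons big_nil padoSr //; last by lia.
case: (leqP 2 m) => m2; case: (leqP r m) => mr.
- rewrite (_ : r + m - 2 = r + (m - 2))%N; last by lia.
  by rewrite (_ : r + m - r = r + (m - r))%N; lia.
- rewrite (_ : r + m - 2 = r + (m - 2))%N; last by lia.
  by rewrite (@pado_small r (r + m - r)); lia.
- by lia.
by rewrite !pado_small; lia.
Qed.

End Series.

Theorem theorem5 (r : nat) (r_ge3 : (3 <= r)%N) :
  [/\ forall n : nat, (r - 1 <= n)%N ->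
        thdet (1 : int) [tuple (trib r k)%:Z | k < n]
          = (-1) ^+ (n - 1) * (fib (n + 1 - r))%:Z,
      forall n : nat, (2 <= n)%N ->
        thdet (1 : int) [tuple (trib r (r - 2 + k))%:Z | k < n]
          = (-1) ^+ (n - 1) * (nara r (n - 2))%:Z,
      forall n : nat, (1 <= n)%N ->
        thdet (1 : int) [tuple (trib r (r - 1 + k))%:Z | k < n]
          = (-1) ^+ (n - 1) * (pado r (n + r - 1))%:Z
    & forall n : nat, (3 <= n)%N ->
        thdet (1 : int) [tuple (trib r (r + k))%:Z | k < n]
          = (-1) ^+ (n - 1) * (n == r)%:R].
Proof.
split=> n n_ge.
- rewrite (thdet_shift_inverse _ _ _ _ _ _ (fun k => (trib r k)%:Z)
             _ _ (trib_series r n r_ge3) (fib_series r n)) => [||| k]; try by lia.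
    (* The case n < r leaves only n = r - 1, where F_0 = 0. *)
    case: ltnP => n_r; last by rewrite addn1 subSn.
    by rewrite (_ : n + 1 - r = 0)%N //; lia.
  case: ifP => k_r; first by rewrite trib_small //; lia.
  by congr (Posz (trib _ _)); lia.
- rewrite (thdet_shift_inverse _ _ _ _ _ _ (fun k => (trib r (r - 2 + k))%:Z)
             _ _ (trib_series r n r_ge3) (nara_series r n r_ge3)) => [||| k] //.
  + by rewrite ltnNge n_ge.
  + by lia.
  case: ifP => k_r; first by rewrite trib_small //; lia.
  by congr (Posz (trib _ _)); lia.
- rewrite (thdet_shift_inverse _ _ _ _ _ _ (fun k => (trib r (r - 1 + k))%:Z)
             _ _ (trib_series r n r_ge3) (pado_series r n r_ge3)) => [|||k] //.
    rewrite ltnNge n_ge /=; congr (_ * Posz (pado _ _)); lia.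
  by rewrite subSS subn0.
have := thdet_inverse _ _ _ _ _ (trib_series r n r_ge3).
rewrite coef_poly /= addn0 subn1 trib_pred => /(_ erefl) detE.
transitivity (thdet (1 : int)
    [tuple (\poly_(i < n.+1) (trib r (r - 1 + i))%:Z)`_k.+1 | k < n]).
  congr (thdet _ _); apply: eq_mktuple => k; rewrite coef_poly ltnS ltn_ord.
  by congr (Posz (trib _ _)); lia.
rewrite subn1 detE !big_cons big_nil addr0 expr1 coefB !coefD coef1 coefX !coefXn.
(* For n >= 3 the only term of q that can contribute is -X^r, whose sign again gives the exponent n
   - 1. *)
case: n n_ge {detE} => [|[|[|n]]] // _.
by rewrite subSS subn0 !add0r exprS mulN1r mulNr mulrN opprK.
Qed.
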